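(* Let $F$ be a reproducing kernel Hilbert space of real-valued functions on a set $D$ with kernel $K$, let $S=\langle\cdot,h\rangle$ for some $h\in F$, and let $\alpha>0$. (i) For all $\mathcal X_n=\{x_1,\dots,x_n\}\subset D$ the following two statements are equivalent: - the matrix $\bigl(K(x_j,x_k)-\alpha h(x_j)h(x_k)\bigr)_{j,k\le n}$ is positive semi-definite; - $e(\mathcal X_n,S)^2\ge\|h\|^2-\alpha^{-1}$. (ii) For all $n\in\mathbb N$ the following two statements are equivalent: - the matrix $\bigl(K(x_j,x_k)-\alpha h(x_j)h(x_k)\bigr)_{j,k\le n}$ is positive semi-definite for all $x_1,\dots,x_n\in D$; - $e(n,S)^2\ge\|h\|^2-\alpha^{-1}$.
   Context: For a continuous linear functional $S$ on a RKHS $F$ of real-valued functions on $D$, points $\mathcal X_n=\{x_1,\dots,x_n\}\subset D$ and $c\in\mathbb R^n$, put $Q_{c,\mathcal X_n}(f)=\sum_{j=1}^nc_jf(x_j)$ and $$e(Q_{c,\mathcal X_n},S)=\sup_{\|f\|_F\le1}|S(f)-Q_{c,\mathcal X_n}(f)|,\qquad e(\mathcal X_n,S)=\inf_{c\in\mathbb R^n}e(Q_{c,\mathcal X_n},S),\qquad e(n,S)=\inf_{\mathcal X_n\subset D}e(\mathcal X_n,S),$$ the last infimum being over all choices of $x_1,\dots,x_n\in D$. *)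

(* Defs.v *)
From HB Require Import structures.
From mathcomp Require Import all_boot all_order all_algebra.
From mathcomp Require Import sesquilinear.
From mathcomp Require Import all_classical all_reals all_analysis.

Set Implicit Arguments.
Unset Strict Implicit.
Unset Printing Implicit Defensive.

Import Order.TTheory GRing.Theory Num.Theory.
Import numFieldNormedType.Exports.

Local Open Scope classical_set_scope.
Local Open Scope ring_scope.

(* Over the reals, [{dot F for idfun}] is the type of symmetric positive
   definite bilinear forms on [F]. *)
HB.mixin Record hasDotProduct (R : realType) F & CompleteNormedModule R F := {
  dotp : {dot F for idfun} ;
  sqr_normE : forall f : F, `|f| ^+ 2 = dotp f f
}.

#[short(type="hilbertType")]
HB.structure Definition Hilbert (R : realType) :=
  {F of CompleteNormedModule R F & hasDotProduct R F}.

(* A Hilbert space whose elements are the functions [D -> R] satisfying [P],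
   with pointwise addition and scaling. An element [f] is turned into the
   function it denotes by [\val f]. *)
#[short(type="functionHilbertType")]
HB.structure Definition FunctionHilbert (R : realType) (D : Type)
    (P : pred (D -> R)) :=
  {F of @GRing.SubLmodule R (D -> R) P F & Hilbert R F}.

Section Errors.
Context {R : realType} {D : Type} {P : pred (D -> R)}.
Variable F : functionHilbertType P.
Implicit Types (f : F) (S Q : F -> R).

(* The existence of such a [K] is what makes [F] a reproducing kernel Hilbert
   space; in particular it makes all point evaluations continuous. *)
Definition reproducing_kernel (K : D -> D -> R) : Prop :=
  forall x : D, exists2 k : F,
    \val k = (fun y => K y x) & forall f, \val f x = dotp f k.

Definition quadrature n (c : 'rV[R]_n) (x : 'I_n -> D) f : R :=
  \sum_(j < n) c 0 j * \val f (x j).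

(* Errors are extended reals: no junk value for an unbounded supremum, and the
   infimum over an empty family of points is [+oo]. *)
Definition worst_case_error S Q : \bar R :=
  ereal_sup [set (`|S f - Q f|)%:E | f in [set f : F | `|f| <= 1]].

(* The points need not be distinct. *)
Definition points_error S n (x : 'I_n -> D) : \bar R :=
  ereal_inf [set worst_case_error S (quadrature c x) | c in [set: 'rV[R]_n]].

Definition minimal_error S (n : nat) : \bar R :=
  ereal_inf [set points_error S x | x in [set: 'I_n -> D]].

End Errors.

Definition psdmx {R : realType} n (A : 'M[R]_n) : Prop :=
  A^T = A /\ forall v : 'cV[R]_n, 0 <= (v^T *m A *m v) 0 0.

(* Main.v *)
(* The worst case error of [quadrature c x] is the distance from [h] to
   [g = \sum_j c_j K(., x_j)], and the quadratic form of
   [K(x_j, x_k) - alpha h(x_j) h(x_k)] at [c] is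
   [`|g|^2 - alpha <g, h>^2]. So both conditions concern the span of the
   [K(., x_j)]: positivity says [alpha <g, h>^2 <= `|g|^2] there, while the
   error bound says [0 <= `|g|^2 - 2 <g, h> + alpha^-1]. They are equivalent
   because the span is stable under scaling of [g]. *)
Require Import Defs.
From HB Require Import structures.
From mathcomp Require Import all_boot all_order all_algebra.
From mathcomp Require Import sesquilinear.
From mathcomp Require Import all_classical all_reals all_analysis.
From mathcomp Require Import ring lra.

Set Implicit Arguments.
Unset Strict Implicit.
Unset Printing Implicit Defensive.

Import Order.TTheory GRing.Theory Num.Theory.
Import numFieldNormedType.Exports.

Local Open Scope ring_scope.

(** For [r < 0] both sides hold, since [Num.sqrt r] is then 0; so the sign of [|h|^2 - alpha^-1]
    never has to be discussed. *)
Lemma le_EFin_sqr (R : realType) (r : R) (y : \bar R) : (0 <= y)%E ->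
  (r%:E <= y ^+ 2)%E = ((Num.sqrt r)%:E <= y)%E.
Proof.
case: y => [y|_|//]; last by rewrite expeS/= mulyy !leey.
rewrite lee_fin => y0; rewrite -EFin_expe !lee_fin.
by rewrite -(ler_sqrt r (sqr_ge0 y)) sqrtr_sqr ger0_norm.
Qed.

(** Taking square roots turns the claim into a lower bound on an infimum, so the infimum need not be
    attained. It serves for the weights and for the points; for empty [T] both sides hold. *)
Lemma le_EFin_sqr_ereal_inf (R : realType) (r : R) (T : Type) (f : T -> \bar R) :
  (forall t, (0 <= f t)%E) ->
  (r%:E <= ereal_inf [set f t | t in [set: T]] ^+ 2)%E <->
  (forall t, (r%:E <= f t ^+ 2)%E).
Proof.
move=> f0; rewrite le_EFin_sqr; last by apply/ereal_infP => _ [t _ <-].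
split=> [/ereal_infP rf t|rf].
  by rewrite le_EFin_sqr//; apply: rf; exists t.
by apply/ereal_infP => _ [t _ <-]; rewrite -le_EFin_sqr.
Qed.

Lemma dotpC (R : realType) (F : hilbertType R) (f g : F) :
  dotp f g = dotp g f.
Proof. by rewrite hermC expr0 mul1r. Qed.

Lemma dotpZl (R : realType) (F : hilbertType R) (t : R) (f g : F) :
  dotp (t *: f) g = t * dotp f g.
Proof. exact: linearZl_LR. Qed.

Lemma dotpZr (R : realType) (F : hilbertType R) (t : R) (f g : F) :
  dotp f (t *: g) = t * dotp f g.
Proof. exact: linearZr_LR. Qed.

Lemma dotpBr (R : realType) (F : hilbertType R) (f g h : F) :
  dotp f (g - h) = dotp f g - dotp f h.
Proof. exact: linearBr. Qed.

Lemma sqr_normZ (R : realType) (F : hilbertType R) (t : R) (f : F) :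
  `|t *: f| ^+ 2 = t ^+ 2 * `|f| ^+ 2.
Proof. by rewrite normrZ exprMn real_normK ?num_real. Qed.

Lemma sqr_normB (R : realType) (F : hilbertType R) (f g : F) :
  `|f - g| ^+ 2 = `|f| ^+ 2 - 2 * dotp f g + `|g| ^+ 2.
Proof.
rewrite !sqr_normE linearBl/= !dotpBr (dotpC g f); ring.
Qed.

Lemma cauchy_schwarz (R : realType) (F : hilbertType R) (f g : F) :
  `|dotp f g| <= `|f| * `|g|.
Proof.
have [->|g0] := eqVneq g 0; first by rewrite linear0r !normr0 mulr0.
have N0 : 0 < `|g| ^+ 2 by rewrite exprn_gt0// normr_gt0.
rewrite -ler_sqr ?nnegrE ?mulr_ge0// real_normK ?num_real// exprMn.
(* The component of [f] orthogonal to [g], multiplied by [|g|^2] to avoid division. *)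
have := sqr_ge0 `| `|g| ^+ 2 *: f - dotp f g *: g|.
rewrite sqr_normB !sqr_normZ dotpZl dotpZr.
set N := `|g| ^+ 2 in N0 *; set M := `|f| ^+ 2; set u := dotp f g.
have -> : N ^+ 2 * M - 2 * (N * (u * u)) + u ^+ 2 * N = N * (M * N - u ^+ 2).
  ring.
by rewrite pmulr_rge0// subr_ge0.
Qed.

(** The Riesz isometry: Cauchy-Schwarz gives the upper bound, attained at [g / |g|], or at 0 if
    [g = 0]. *)
Lemma ereal_sup_dotp (R : realType) (F : hilbertType R) (g : F) :
  ereal_sup [set `|dotp f g|%:E | f in [set f : F | `|f| <= 1]]%classic
  = `|g|%:E.
Proof.
apply/eqP; rewrite eq_le; apply/andP; split.
  apply/ereal_supP => _ [f /= f1 <-]; rewrite lee_fin.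
  by rewrite (le_trans (cauchy_schwarz f g))// ler_piMl.
apply: ereal_sup_ubound; have [->|g0] := eqVneq g 0.
  by exists 0; rewrite /= ?normr0// linear0l normr0.
have N0 : `|g| != 0 by rewrite normr_eq0.
exists (`|g|^-1 *: g); first by rewrite /= normrZ normfV normr_id mulVf.
by rewrite dotpZl -sqr_normE expr2 mulrA mulVf// mul1r normr_id.
Qed.

Lemma worst_case_error_ge0 (R : realType) (D : Type) (P : pred (D -> R))
    (F : functionHilbertType P) (S Q : F -> R) :
  (0 <= worst_case_error S Q)%E.
Proof.
apply: (@le_trans _ _ (`|S 0 - Q 0|)%:E); first by rewrite lee_fin.
by apply: ereal_sup_ubound; exists 0; rewrite //= normr0.
Qed.

Lemma points_error_ge0 (R : realType) (D : Type) (P : pred (D -> R))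
    (F : functionHilbertType P) (S : F -> R) n (x : 'I_n -> D) :
  (0 <= points_error S x)%E.
Proof.
by apply/ereal_infP => _ [c _ <-]; exact: worst_case_error_ge0.
Qed.

Definition lincomb (R : realType) (F : lmodType R) n (u : 'I_n -> F)
  (c : 'rV[R]_n) : F := \sum_(j < n) c 0 j *: u j.

Lemma lincombZ (R : realType) (F : lmodType R) n (u : 'I_n -> F) (t : R)
  (c : 'rV[R]_n) : lincomb u (t *: c) = t *: lincomb u c.
Proof.
by rewrite /lincomb scaler_sumr; apply: eq_bigr => j _; rewrite mxE scalerA.
Qed.

Lemma dotp_lincombr (R : realType) (F : hilbertType R) n (u : 'I_n -> F)
    (c : 'rV[R]_n) (f : F) :
  dotp f (lincomb u c) = \sum_(j < n) c 0 j * dotp f (u j).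
Proof.
by rewrite /lincomb linear_sumr; apply: eq_bigr => j _; exact: dotpZr.
Qed.

(** By the reproducing property, the error functional is the inner product with
    [h - lincomb (k \o x) c]. *)
Lemma worst_case_error_quadrature (R : realType) (D : Type)
    (P : pred (D -> R)) (F : functionHilbertType P) (k : D -> F)
    (hk : forall x f, \val f x = dotp f (k x)) (h : F) (S : F -> R)
    (hS : forall f : F, S f = dotp f h) n (x : 'I_n -> D) (c : 'rV[R]_n) :
  worst_case_error S (quadrature c x)
  = `|h - lincomb (k \o x) c|%:E.
Proof.
rewrite -ereal_sup_dotp; congr ereal_sup; apply: eq_imagel => f _.
rewrite hS dotpBr dotp_lincombr /quadrature.
by under eq_bigr do rewrite hk.
Qed.

Lemma quad_form_gram_sub (R : realType) (F : hilbertType R) n (u : 'I_n -> F)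
    (h : F) (alpha : R) (v : 'cV[R]_n) :
  (v^T *m (\matrix_(j, k)
     (dotp (u k) (u j) - alpha * dotp h (u j) * dotp h (u k))) *m v) 0 0
  = `|lincomb u v^T| ^+ 2 - alpha * dotp h (lincomb u v^T) ^+ 2.
Proof.
set w := lincomb u v^T; set b := dotp h w.
have bE : b = \sum_(j < n) v j 0 * dotp h (u j).
  by rewrite /b dotp_lincombr; apply: eq_bigr => j _; rewrite mxE.
(* Only one factor of [b * b] is expanded here, to compare both sides summand by summand in [k]; the
   other is expanded inside each summand. *)
rewrite sqr_normE [dotp w w]dotp_lincombr expr2 {2}bE mulrA mulr_sumr -sumrB mxE.
apply: eq_bigr => k _; rewrite (dotpC w) dotp_lincombr bE !mxE.
rewrite mulrC [_ * (v k 0 * _)]mulrCA -mulrBr; congr (_ * _).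
rewrite mulr_sumr mulr_suml -sumrB; apply: eq_bigr => j _; rewrite !mxE; ring.
Qed.

Lemma quadratic_ge0_discr (R : realType) (alpha N b : R) : 0 < alpha ->
  (forall t, 0 <= t ^+ 2 * N - 2 * (t * b) + alpha^-1) -> 0 <= N ->
  alpha * b ^+ 2 <= N.
Proof.
move=> a0 q N0; have [->|b0] := eqVneq b 0; first by rewrite expr0n/= mulr0.
have ab0 : 0 < alpha * b ^+ 2 by rewrite mulr_gt0// exprn_even_gt0.
(* At [t = (alpha b)^-1] the quadratic equals [N / (alpha b)^2 - alpha^-1]. Unlike the minimiser
   [b / N], this [t] requires no [N != 0]. *)
have := mulr_ge0 (ltW ab0) (mulr_ge0 (ltW a0) (q (alpha * b)^-1)).
have -> : alpha * b ^+ 2 * (alpha * ((alpha * b)^-1 ^+ 2 * N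
    - 2 * ((alpha * b)^-1 * b) + alpha^-1)) = N - alpha * b ^+ 2.
  by field; rewrite b0 gt_eqF.
by rewrite subr_ge0.
Qed.

Lemma gram_sub_psdP (R : realType) (F : hilbertType R) n (u : 'I_n -> F)
    (h : F) (alpha : R) : 0 < alpha ->
  psdmx (\matrix_(j, k)
    (dotp (u k) (u j) - alpha * dotp h (u j) * dotp h (u k))) <->
  forall c : 'rV[R]_n, `|h| ^+ 2 - alpha^-1 <= `|h - lincomb u c| ^+ 2.
Proof.
move=> a0; split=> [[_ psd] c|dist_ge].
  have := psd c^T; rewrite quad_form_gram_sub trmxK sqr_normB.
  set b := dotp h _; set N := `|lincomb u c| ^+ 2 => abN.
  (* completing the square: [alpha b^2 - 2 b + alpha^-1 = (alpha b - 1)^2 / alpha] *)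
  have : 0 <= (alpha * b - 1) ^+ 2 / alpha.
    by rewrite divr_ge0 ?sqr_ge0// ltW.
  have -> : (alpha * b - 1) ^+ 2 / alpha = alpha * b ^+ 2 - 2 * b + alpha^-1.
    by field; rewrite gt_eqF.
  lra.
split.
  by apply/matrixP => j k; rewrite !mxE dotpC; ring.
move=> v; rewrite quad_form_gram_sub subr_ge0.
(* The bound is used at all multiples [t *: v^T]; there [|h|^2] cancels and a quadratic in [t]
   remains. *)
apply: quadratic_ge0_discr => // t.
have := dist_ge (t *: v^T).
rewrite lincombZ sqr_normB sqr_normZ dotpZr; lra.
Qed.

Theorem proposition1 (R : realType) (D : Type) (P : pred (D -> R))
    (F : functionHilbertType P) (K : D -> D -> R)
    (hK : reproducing_kernel F K) (h : F) (S : F -> R)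
    (hS : forall f : F, S f = dotp f h) (alpha : R) (alpha_gt0 : 0 < alpha) :
  (forall (n : nat) (x : 'I_n -> D),
     psdmx (\matrix_(j < n, k < n)
              (K (x j) (x k) - alpha * \val h (x j) * \val h (x k)))
     <->
     ((`|h| ^+ 2 - alpha^-1)%R%:E <= points_error S x ^+ 2)%E)
  /\
  (forall n : nat,
     (forall x : 'I_n -> D,
        psdmx (\matrix_(j < n, k < n)
                 (K (x j) (x k) - alpha * \val h (x j) * \val h (x k))))
     <->
     ((`|h| ^+ 2 - alpha^-1)%R%:E <= minimal_error S n ^+ 2)%E).
Proof.
have [k [hKk hk]] : exists k : D -> F, (forall x, \val (k x) = K^~ x) /\
    forall x f, \val f x = dotp f (k x).
  have /choice[k hk] : forall x, exists k : F, \val k = K^~ x /\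
      forall f, \val f x = dotp f k by move=> x; have [k] := hK x; exists k.
  by exists k; split=> x; case: (hk x).
have part1 n (x : 'I_n -> D) :
    psdmx (\matrix_(j < n, k < n)
      (K (x j) (x k) - alpha * \val h (x j) * \val h (x k)))
    <-> ((`|h| ^+ 2 - alpha^-1)%R%:E <= points_error S x ^+ 2)%E.
  (* The value of [k (x j)] at [x i] is [K (x i) (x j)], hence the swapped indices in the Gram
     matrix. *)
  have -> : \matrix_(j < n, k < n)
      (K (x j) (x k) - alpha * \val h (x j) * \val h (x k))
      = \matrix_(i, j) (dotp ((k \o x) j) ((k \o x) i)
          - alpha * dotp h ((k \o x) i) * dotp h ((k \o x) j)).
    by apply/matrixP => i j; rewrite !mxE /= -!hk hKk.
  rewrite (gram_sub_psdP _ _ alpha_gt0) le_EFin_sqr_ereal_inf; last first.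
    by move=> c; exact: worst_case_error_ge0.
  by split=> dist_ge c; have := dist_ge c;
    rewrite (worst_case_error_quadrature hk hS) -EFin_expe lee_fin.
(* The bound on the infimum over point families is the bound for each family, so (ii) reduces to
   (i). *)
split=> // n; rewrite le_EFin_sqr_ereal_inf; last exact: points_error_ge0.
by split=> psd x; apply/part1.
Qed.
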